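(* Let $I$ be an interval of $\mathbb{R}$, let $n\in\mathbb{N}$, let $A: I\to\mathbb{C}^{n\times n}$ be a continuous matrix function and $\bm{f}: I\to\mathbb{C}^n$ a continuous vector function, and let $K>0$. Then the equation $\bm{x}'=A(t)\bm{x}+\bm{f}(t)$ is Ulam stable on $I$ with Ulam constant $K$ if and only if the equation $\bm{x}'=A(t)\bm{x}$ is Ulam stable on $I$ with the same Ulam constant $K$.
   Context: Fix a norm $\|\cdot\|$ on $\mathbb{C}^n$. For continuous $A: I\to\mathbb{C}^{n\times n}$ and $\bm{f}: I\to\mathbb{C}^n$, the equation $\bm{x}'=A(t)\bm{x}+\bm{f}(t)$ is called Ulam stable on $I$ if there is a constant $K>0$ such that: for every $\varepsilon>0$ and every continuously differentiable $\bm{\phi}: I\to\mathbb{C}^n$ with $\sup_{t\in I}\|\bm{\phi}'(t)-A(t)\bm{\phi}(t)-\bm{f}(t)\|\le\varepsilon$, there exists a solution $\bm{x}: I\to\mathbb{C}^n$ of $\bm{x}'=A(t)\bm{x}+\bm{f}(t)$ with $\sup_{t\in I}\|\bm{\phi}(t)-\bm{x}(t)\|\le K\varepsilon$. Any such $K$ is called an Ulam constant for the equation on $I$. The homogeneous equation is the case $\bm{f}\equiv\bm{0}$. *)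

(* Defs.v *)
From HB Require Import structures.
From mathcomp Require Import all_boot all_order all_algebra.
From mathcomp Require Import all_classical all_reals all_analysis.
From mathcomp Require Export complex.

Set Implicit Arguments.
Unset Strict Implicit.
Unset Printing Implicit Defensive.
Import Order.TTheory GRing.Theory Num.Theory.
Import numFieldNormedType.Exports.

Local Open Scope classical_set_scope.
Local Open Scope ring_scope.
Local Open Scope complex_scope.

(* The library puts the topology of a numFieldType on its regular algebra
   [_^o]; this makes it available on [R[i]] itself, hence entrywise on
   vectors and matrices over [R[i]]. *)
#[warnings="-redundant-canonical-projection"]
HB.instance Definition _ (R : realType) := NormedModule.copy R[i] R[i]^o.

Record is_norm (R : realType) (n : nat) (N : 'cV[R[i]]_n -> R) : Prop := IsNorm {
  is_norm_ge0 : forall v, 0 <= N v ;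
  is_norm_eq0 : forall v, N v = 0 -> v = 0 ;
  is_normD : forall v w, N (v + w) <= N v + N w ;
  is_normZ : forall (a : R[i]) v, N (a *: v) = ComplexField.Normc.normc a * N v
}.

(* Functions on [I] are represented by total functions on [R] of which only the
   values on [I] matter. The derivative is the limit of difference quotients
   taken inside [I], hence one-sided at an endpoint belonging to [I]; when [I]
   is reduced to a point, every vector is a derivative at that point. *)
Definition has_derivative_on (R : realType) (n : nat) (I : set R)
    (phi dphi : R -> 'cV[R[i]]_n) : Prop :=
  forall t, I t ->
    ((s - t)%:C^-1 *: (phi s - phi t)) @[s --> within I t^'] --> dphi t.

Definition C1_on (R : realType) (n : nat) (I : set R)
    (phi dphi : R -> 'cV[R[i]]_n) : Prop :=
  has_derivative_on I phi dphi /\ {within I, continuous dphi}.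

Definition is_solution (R : realType) (n : nat) (I : set R)
    (A : R -> 'M[R[i]]_n) (f x : R -> 'cV[R[i]]_n) : Prop :=
  has_derivative_on I x (fun t => A t *m x t + f t).

(* In [\bar R], so the supremum is [+oo] when unbounded
   and [-oo] when [I] is empty. *)
Definition sup_norm (R : realType) (n : nat) (N : 'cV[R[i]]_n -> R) (I : set R)
    (g : R -> 'cV[R[i]]_n) : \bar R :=
  ereal_sup [set (N (g t))%:E | t in I].

(* The equation [x' = A x + f] is Ulam stable on [I] with Ulam constant [K];
   Ulam stability on [I] is the existence of such a [K]. *)
Definition ulam_stable_with (R : realType) (n : nat) (N : 'cV[R[i]]_n -> R)
    (I : set R) (A : R -> 'M[R[i]]_n) (f : R -> 'cV[R[i]]_n) (K : R) : Prop :=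
  0 < K /\
  forall (eps : R) (phi dphi : R -> 'cV[R[i]]_n),
    0 < eps -> C1_on I phi dphi ->
    (sup_norm N I (fun t => dphi t - (A t *m phi t) - f t)%R <= eps%:E)%E ->
    exists x : R -> 'cV[R[i]]_n, is_solution I A f x /\
      (sup_norm N I (fun t => phi t - x t)%R <= (K * eps)%:E)%E.

(* Main.v *)
(** Shifting by a particular solution [x0] of [x' = A x + h] turns the defect of
    [phi] for the forcing term [g] into that of [phi - x0] for [g - h], without
    changing any norm, so both directions follow once [x' = A x + h] is known to
    have a solution on all of [I].  That solution is obtained for the underlying
    real linear system by Picard iteration: in the norm weighted by
    [exp (2 M |t - t0|)], where [M] bounds the row sums of the coefficients, the
    Picard operator halves distances.  As [A] and [h] may be unbounded near an
    endpoint not in [I], this is done on compact subintervals containing [t0],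
    and the solutions, unique by the same contraction, are glued. *)
Require Import Defs.
From mathcomp Require Import all_boot all_order all_algebra.
From mathcomp Require Import all_classical all_reals all_analysis.
From mathcomp Require Import ring lra.
Import Order.TTheory GRing.Theory Num.Theory.
Import numFieldNormedType.Exports.

Set Implicit Arguments.
Unset Strict Implicit.
Unset Printing Implicit Defensive.

Local Open Scope classical_set_scope.
Local Open Scope ring_scope.
Local Open Scope complex_scope.

Lemma antiderivative (R : realType) (c d t0 : R) (g : R -> R) :
  c <= d -> {within `[c, d], continuous g} ->
  exists G : R -> R, [/\ {within `[c, d], continuous G}, G t0 = 0 &
    forall t, t \in `]c, d[ -> is_derive t 1 G (g t)].
Proof.
move=> cd gc.
have gi : (@lebesgue_measure R).-integrable `[c, d] (EFin \o g).
  by apply: continuous_compact_integrable => //; exact: segment_compact.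
pose F x := parameterized_integral (@lebesgue_measure R) c x g.
have Fc : {within `[c, d], continuous F}.
  exact: (parameterized_integral_continuous cd gi).
exists (fun x => F x - F t0); split; last 2 first.
- by rewrite subrr.
- move=> t tcd.
  have [ct td] : c < t /\ t < d by move: tcd; rewrite in_itv /= => /andP[].
  have gt : {for t, continuous g} by exact: within_continuous_continuous (lt_trans ct td) gc tcd.
  have [dF F'] := continuous_FTC1_closed td gi ct gt.
  have HF : is_derive t 1 F (g t) by apply: (DeriveDef dF); rewrite -derive1E F'.
  by rewrite -[g t]subr0; exact: (is_deriveB HF (is_derive_cst (F t0) t 1)).
- by move=> x; apply: continuousB => //; [exact: Fc|exact: cst_continuous].
Qed.

Lemma derive_dominated (R : realType) (p q : R) (h dh H dH : R -> R) :
  p <= q -> {within `[p, q], continuous h} -> {within `[p, q], continuous H} ->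
  (forall t, t \in `]p, q[ -> is_derive t 1 h (dh t)) ->
  (forall t, t \in `]p, q[ -> is_derive t 1 H (dH t)) ->
  (forall t, t \in `]p, q[ -> `|dh t| <= dH t) ->
  `|h q - h p| <= H q - H p.
Proof.
rewrite le_eqVlt => /predU1P[<- *|pq hc Hc hd Hd dhH]; first by rewrite !subrr normr0.
have [s spq] := MVT pq (fun t tpq => is_deriveB (Hd t tpq) (hd t tpq))
  (fun x => continuousB (Hc x) (hc x)).
have [r rpq] := MVT pq (fun t tpq => is_deriveD (Hd t tpq) (hd t tpq))
  (fun x => continuousD (Hc x) (hc x)).
rewrite /= => e1 e2.
have := dhH _ spq; have := dhH _ rpq; rewrite !ler_norml => /andP[r1 r2] /andP[s1 s2].
have : 0 <= (H - h) q - (H - h) p by rewrite e2 mulr_ge0 ?subr_ge0// (ltW pq).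
have : 0 <= (H + h) q - (H + h) p by rewrite e1 mulr_ge0 ?subr_ge0 ?(ltW pq)// -lerBlDl sub0r.
rewrite !fctE => *; apply/andP; split; lra.
Qed.

Lemma weighted_bound (R : realType) (c d t0 M C : R) (h dh : R -> R) :
  0 < M -> t0 \in `[c, d] -> {within `[c, d], continuous h} -> h t0 = 0 ->
  (forall t, t \in `]c, d[ -> is_derive t 1 h (dh t)) ->
  (forall t, t \in `]c, d[ -> `|dh t| <= M * (C * expR (2 * M * `|t - t0|))) ->
  0 <= C -> forall t, t \in `[c, d] -> `|h t| <= C / 2 * expR (2 * M * `|t - t0|).
Proof.
move=> M0; rewrite in_itv /= => /andP[ct0 t0d] hc ht0 hd dhw C0 t.
rewrite in_itv /= => /andP[ct td].
have [t0t|tt0] := leP t0 t.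
- pose H : R -> R := (C / 2) *: (expR \o (fun s => 2 * M * (s - t0))).
  pose dH (s : R) : R := M * (C * expR (2 * M * (s - t0))).
  have Hd (s : R) : is_derive s 1 H (dH s).
    rewrite /H /dH; apply: is_derive_eq.
    by rewrite /GRing.scale /=; field.
  have HC : H t - H t0 <= C / 2 * expR (2 * M * (t - t0)).
    by rewrite /H !fctE /GRing.scale /= gerBl mulr_ge0 ?expR_ge0// divr_ge0.
  suff hH : `|h t - h t0| <= H t - H t0.
    rewrite [`|t - t0|]ger0_norm ?subr_ge0//.
    by apply: le_trans HC; rewrite ht0 subr0 in hH.
  have hd' s : s \in `]t0, t[ -> is_derive s 1 h (dh s).
    rewrite in_itv /= => /andP[s1 s2]; apply: hd.
    by rewrite in_itv /= (le_lt_trans ct0 s1) (lt_le_trans s2 td).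
  refine (derive_dominated t0t _ _ hd' (fun s _ => Hd s) _).
  + by apply: continuous_subspaceW hc; apply: subset_itv; rewrite bnd_simp.
  + apply: continuous_subspaceT => s.
    by apply: differentiable_continuous; apply/derivable1_diffP; case: (Hd s).
  + move=> s; rewrite in_itv /= => /andP[s1 s2].
    rewrite /dH -[s - t0]ger0_norm ?subr_ge0 ?(ltW s1)//; apply: dhw.
    by rewrite in_itv /= (le_lt_trans ct0 s1) (lt_le_trans s2 td).
- pose H : R -> R := (- (C / 2)) *: (expR \o (fun s => 2 * M * (t0 - s))).
  pose dH (s : R) : R := M * (C * expR (2 * M * (t0 - s))).
  have Hd (s : R) : is_derive s 1 H (dH s).
    rewrite /H /dH; apply: is_derive_eq.
    by rewrite /GRing.scale /=; field.
  have HC : H t0 - H t <= C / 2 * expR (2 * M * (t0 - t)).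
    rewrite /H !fctE /GRing.scale /= !mulNr opprK gerDr oppr_le0.
    by rewrite mulr_ge0 ?expR_ge0// divr_ge0.
  suff hH : `|h t0 - h t| <= H t0 - H t.
    rewrite [`|t - t0|]distrC [`|t0 - t|]gtr0_norm ?subr_gt0//.
    by apply: le_trans HC; rewrite ht0 sub0r normrN in hH.
  have hd' s : s \in `]t, t0[ -> is_derive s 1 h (dh s).
    rewrite in_itv /= => /andP[s1 s2]; apply: hd.
    by rewrite in_itv /= (le_lt_trans ct s1) (lt_le_trans s2 t0d).
  refine (derive_dominated (ltW tt0) _ _ hd' (fun s _ => Hd s) _).
  + by apply: continuous_subspaceW hc; apply: subset_itv; rewrite bnd_simp.
  + apply: continuous_subspaceT => s.
    by apply: differentiable_continuous; apply/derivable1_diffP; case: (Hd s).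
  + move=> s; rewrite in_itv /= => /andP[s1 s2].
    rewrite /dH -[t0 - s]ger0_norm ?subr_ge0 ?(ltW s2)// distrC; apply: dhw.
    by rewrite in_itv /= (le_lt_trans ct s1) (lt_le_trans s2 t0d).
Qed.

Definition solves (R : realType) (T : finType) (c d : R)
    (A : T -> T -> R -> R) (g x : T -> R -> R) :=
  (forall i, {within `[c, d], continuous (x i)}) /\
  forall i t, t \in `]c, d[ ->
    is_derive t 1 (x i) (\sum_j A i j t * x j t + g i t).

Lemma picard_contraction (R : realType) (T : finType) (c d t0 M C : R)
    (A : T -> T -> R -> R) (g u v U V : T -> R -> R) :
  0 < M -> 0 <= C -> t0 \in `[c, d] ->
  (forall i t, t \in `[c, d] -> \sum_j `|A i j t| <= M) ->
  (forall i, {within `[c, d], continuous (U i)}) ->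
  (forall i, {within `[c, d], continuous (V i)}) ->
  (forall i, U i t0 = V i t0) ->
  (forall i t, t \in `]c, d[ ->
    is_derive t 1 (U i) (\sum_j A i j t * u j t + g i t)) ->
  (forall i t, t \in `]c, d[ ->
    is_derive t 1 (V i) (\sum_j A i j t * v j t + g i t)) ->
  (forall i t, t \in `[c, d] ->
    `|u i t - v i t| <= C * expR (2 * M * `|t - t0|)) ->
  forall i t, t \in `[c, d] ->
    `|U i t - V i t| <= C / 2 * expR (2 * M * `|t - t0|).
Proof.
move=> M0 C0 t0cd AM Uc Vc UV Ud Vd uv i t tcd.
have := @weighted_bound R c d t0 M C (U i - V i)
  (fun s => \sum_j A i j s * (u j s - v j s)) M0 t0cd.
rewrite !fctE => /(_ _ _ _ _ C0 _ tcd); apply.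
- by move=> x; apply: continuousB; [exact: Uc|exact: Vc].
- by rewrite UV subrr.
- move=> s scd; have := is_deriveB (Ud i s scd) (Vd i s scd).
  congr is_derive; rewrite opprD addrACA subrr addr0 -sumrB.
  by apply: eq_bigr => j _; rewrite mulrBr.
- move=> s scd.
  have scd' : s \in `[c, d] by exact: subset_itv_oo_cc.
  apply: le_trans (ler_norm_sum _ _ _) _.
  apply: (@le_trans _ _ (\sum_j `|A i j s| * (C * expR (2 * M * `|s - t0|)))).
    by apply: ler_sum => j _; rewrite normrM ler_wpM2l// uv.
  by rewrite -mulr_suml ler_wpM2r ?AM// mulr_ge0// expR_ge0.
Qed.

Lemma le_geometric_le0 (R : realType) (a b : R) :
  (forall k, a <= b / 2 ^+ k) -> a <= 0.
Proof.
move=> ab; have half1 : `|2^-1 : R| < 1.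
  by rewrite ger0_norm ?invr_ge0// invf_lt1// ltr1n.
apply: (ler_cvg_to (cvg_cst a) (cvg_geometric b half1)).
by apply: nearW => k; rewrite /geometric /= exprVn.
Qed.

Lemma continuous_family_bound (R : realType) (U : finType) (c d : R)
    (f : U -> R -> R) : c <= d ->
  (forall u, {within `[c, d], continuous (f u)}) ->
  exists2 M, 0 < M & forall t, t \in `[c, d] -> \sum_u `|f u t| <= M.
Proof.
move=> cd fc.
have sc : {within `[c, d], continuous (fun t => \sum_u `|f u t|)}.
  apply: continuous_big => [|u _ x]; first exact: add_continuous.
  by apply: cvg_norm; exact: fc.
have [s scd smax] := EVT_max cd sc.
exists (1 + \sum_u `|f u s|); first by rewrite ltr_pwDl// sumr_ge0.
by move=> t tcd; rewrite (le_trans (smax t tcd))// lerDr.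
Qed.

Lemma coefficient_bound (R : realType) (T : finType) (c d : R)
    (A : T -> T -> R -> R) : c <= d ->
  (forall i j, {within `[c, d], continuous (A i j)}) ->
  exists2 M, 0 < M & forall i t, t \in `[c, d] -> \sum_j `|A i j t| <= M.
Proof.
move=> cd Ac.
have [M M0 AM] := @continuous_family_bound R (T * T)%type c d
  (fun p => A p.1 p.2) cd (fun p => Ac p.1 p.2).
exists M => // i t tcd; apply: le_trans (AM t tcd).
rewrite -(pair_bigA _ (fun i j => `|A i j t|)) /= [leRHS](bigD1 i)//= lerDl.
by rewrite sumr_ge0// => k _; rewrite sumr_ge0.
Qed.

Lemma solves_unique (R : realType) (T : finType) (c d t0 : R)
    (A : T -> T -> R -> R) (g x y : T -> R -> R) :
  t0 \in `[c, d] -> (forall i j, {within `[c, d], continuous (A i j)}) ->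
  solves c d A g x -> solves c d A g y -> (forall i, x i t0 = y i t0) ->
  forall i t, t \in `[c, d] -> x i t = y i t.
Proof.
move=> t0cd Ac [xc xd] [yc yd] xy0.
have cd : c <= d by move: t0cd; rewrite in_itv /= => /andP[]; exact: le_trans.
have [M M0 AM] := coefficient_bound cd Ac.
have [C C0 xyC] : exists2 C, 0 < C &
    forall t, t \in `[c, d] -> \sum_i `|(x i - y i) t| <= C.
  by apply: continuous_family_bound => // i s; exact: (continuousB (xc i s) (yc i s)).
have bound k i t : t \in `[c, d] ->
    `|x i t - y i t| <= C / 2 ^+ k * expR (2 * M * `|t - t0|).
  elim: k i t => [|k IH] i t tcd; last first.
    rewrite exprSr invfM mulrA.
    apply: (picard_contraction M0 _ t0cd AM xc yc xy0 xd yd IH) => //.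
    by rewrite divr_ge0 ?(ltW C0)// exprn_ge0.
  rewrite expr0 divr1; apply: (@le_trans _ _ C).
    apply: le_trans (xyC t tcd); rewrite (bigD1 i)//= !fctE lerDl.
    by rewrite sumr_ge0.
  rewrite ler_peMr ?(ltW C0)// -[leLHS]expR0 ler_expR.
  by rewrite !mulr_ge0// ltW.
move=> i t tcd; apply/eqP; rewrite -subr_eq0 -normr_le0.
apply: (@le_geometric_le0 _ _ (C * expR (2 * M * `|t - t0|))) => k.
by rewrite mulrAC; exact: bound.
Qed.

(* The limit is the supremum of the lower bounds [y k - r k], which are all below
   the upper bounds [y m + r m]. *)
Lemma uniform_cauchy_limit (R : realType) (y r : nat -> R) :
  (forall k m, `|y (k + m)%N - y k| <= r k) ->
  exists x, forall k, `|x - y k| <= r k.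
Proof.
move=> yr.
have r0 k : 0 <= r k by apply: le_trans (yr k 0%N).
have lu k m : y k - r k <= y m + r m.
  have [km|mk] := leqP k m.
    have := yr k (m - k)%N; rewrite subnKC// ler_norml => /andP[h _].
    by have := r0 m; lra.
  have := yr m (k - m)%N; rewrite subnKC ?(ltnW mk)// ler_norml => /andP[_ h].
  by have := r0 k; lra.
pose L := [set y k - r k | k in [set: nat]].
have LU m : ubound L (y m + r m) by move=> _ [k _ <-].
exists (sup L) => k; rewrite ler_norml; apply/andP; split.
  rewrite lerBrDr addrC; apply: ub_le_sup; last by exists k.
  by exists (y 0%N + r 0%N); exact: LU.
rewrite lerBlDr addrC; apply: ge_sup; last exact: LU.
by exists (y 0%N - r 0%N); exists 0%N.
Qed.

Lemma continuous_uniform_approx (R : realType) (c d b : R) (y : nat -> R -> R)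
    (x : R -> R) :
  (forall k, {within `[c, d], continuous (y k)}) ->
  (forall k t, t \in `[c, d] -> `|x t - y k t| <= b / 2 ^+ k) ->
  {within `[c, d], continuous x}.
Proof.
move=> yc xy; apply/subspace_continuousP => s scd.
have {}scd : s \in `[c, d] by [].
apply/cvgrPdist_le => e e0.
have [k ke] : exists k, b / 2 ^+ k <= e / 3.
  apply: contrapT => /forallNP ke; suff : e / 3 <= 0 by lra.
  by apply: (@le_geometric_le0 _ _ b) => k; rewrite leNgt; apply/negP => /ltW /ke.
have /subspace_continuousP/(_ s scd)/cvgrPdist_le/(_ (e / 3)) := yc k.
rewrite divr_gt0// => /(_ isT) H.
near=> t.
have tcd : t \in `[c, d] by near: t; exact: withinT.
have h1 := le_trans (xy k s scd) ke; have h2 := le_trans (xy k t tcd) ke.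
have : `|y k s - y k t| <= e / 3 by near: t.
move: h1 h2; rewrite !ler_norml => /andP[? ?] /andP[? ?] /andP[? ?].
by rewrite /from_subspace; apply/andP; split; lra.
Unshelve. all: by end_near. Qed.

Lemma linear_ivp_solution (R : realType) (T : finType) (c d t0 : R)
    (A : T -> T -> R -> R) (g : T -> R -> R) :
  t0 \in `[c, d] -> (forall i j, {within `[c, d], continuous (A i j)}) ->
  (forall i, {within `[c, d], continuous (g i)}) ->
  exists2 x, solves c d A g x & forall i, x i t0 = 0.
Proof.
move=> t0cd Ac gc.
have cd : c <= d by move: t0cd; rewrite in_itv /= => /andP[]; exact: le_trans.
have [M M0 AM] := coefficient_bound cd Ac.
pose isC (y : T -> R -> R) := forall i, {within `[c, d], continuous (y i)}.
have /choice[P HP] : forall y : T -> R -> R, exists Y : T -> R -> R, isC y ->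
    [/\ isC Y, forall i, Y i t0 = 0 & forall i t, t \in `]c, d[ ->
    is_derive t 1 (Y i) (\sum_j A i j t * y j t + g i t)].
  move=> y; have [yc|] := pselect (isC y); last by exists y.
  have /choice[Y HY] : forall i, exists Yi : R -> R,
      [/\ {within `[c, d], continuous Yi},
      Yi t0 = 0 & forall t, t \in `]c, d[ ->
      is_derive t 1 Yi (\sum_j A i j t * y j t + g i t)].
    move=> i; apply: antiderivative => // s; apply: continuousD; last exact: gc.
    apply: continuous_big => [|j _ r]; first exact: add_continuous.
    by apply: continuousM; [exact: Ac|exact: yc].
  exists Y => _; split=> [i|i|i t]; first by have [] := HY i.
    by have [] := HY i.
  by have [_ _] := HY i; exact.
pose Y k := iter k P (fun _ _ => 0).
have Yc k : isC (Y k).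
  elim: k => [i|k /HP[]//].
  by apply: continuous_subspaceT => s; exact: cst_continuous.
pose w t := expR (2 * M * `|t - t0|).
have [C C0 HC] := continuous_family_bound cd (Yc 1%N).
have w1 t : 1 <= w t by rewrite -[leLHS]expR0 ler_expR !mulr_ge0// ltW.
have YP k : forall i t, t \in `]c, d[ ->
    is_derive t 1 (Y k.+1 i) (\sum_j A i j t * Y k j t + g i t).
  by have [] := HP _ (Yc k).
have Y0 k i : Y k.+1 i t0 = 0 by have [_ + _] := HP _ (Yc k); exact.
have stepY k i t : t \in `[c, d] -> `|Y k.+1 i t - Y k i t| <= C / 2 ^+ k * w t.
  elim: k i t => [|k IH] i t tcd; last first.
    rewrite exprSr invfM mulrA.
    apply: (picard_contraction M0 _ t0cd AM (Yc _) (Yc _) _ (YP k.+1) (YP k) IH) => //.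
      by rewrite divr_ge0 ?(ltW C0)// exprn_ge0.
    by move=> j; rewrite !Y0.
  rewrite expr0 divr1 subr0; apply: (@le_trans _ _ C).
    by apply: le_trans (HC t tcd); rewrite (bigD1 i)//= lerDl sumr_ge0.
  by rewrite ler_peMr ?(ltW C0).
have tailY k m i t : t \in `[c, d] ->
    `|Y (k + m)%N i t - Y k i t| <= 2 * C / 2 ^+ k * w t.
  move=> tcd; apply: (@le_trans _ _ ((2 * C / 2 ^+ k - 2 * C / 2 ^+ (k + m)) * w t)).
    elim: m => [|m IH]; first by rewrite addn0 !subrr normr0 mul0r.
    rewrite addnS -(subrKA (Y (k + m)%N i t)) (le_trans (ler_normD _ _))//.
    apply: le_trans (lerD (stepY _ _ _ tcd) IH) _.
    rewrite -mulrDl ler_wpM2r ?(le_trans _ (w1 t))//.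
    by rewrite le_eqVlt; apply/orP; left; apply/eqP; rewrite exprS; field;
      rewrite !expf_neq0.
  rewrite ler_wpM2r ?(le_trans _ (w1 t))// gerBl.
  by rewrite divr_ge0 ?exprn_ge0// mulr_ge0// ltW.
have [x xY] : exists x : T -> R -> R, forall i t, t \in `[c, d] ->
    forall k, `|x i t - Y k i t| <= 2 * C / 2 ^+ k * w t.
  have /choice[x Hx] : forall p : T * R, exists v, p.2 \in `[c, d] ->
      forall k, `|v - Y k p.1 p.2| <= 2 * C / 2 ^+ k * w p.2.
    move=> [i t] /=; have [tcd|] := boolP (t \in `[c, d]); last by exists 0.
    have [v Hv] := @uniform_cauchy_limit R (fun k => Y k i t)
      (fun k => 2 * C / 2 ^+ k * w t) (fun k m => tailY k m i t tcd).
    by exists v.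
  by exists (fun i t => x (i, t)) => i t; exact: (Hx (i, t)).
have xc : isC x.
  move=> i; apply: (@continuous_uniform_approx _ _ _ (2 * C * expR (2 * M * (d - c)))
    (fun k => Y k i)) => [k|k t tcd]; first exact: Yc.
  apply: le_trans (xY i t tcd k) _; rewrite mulrAC ler_wpM2r ?invr_ge0 ?exprn_ge0//.
  rewrite ler_wpM2l ?mulr_ge0 ?(ltW C0)// ler_expR ler_wpM2l ?mulr_ge0 ?(ltW M0)//.
  move: tcd t0cd; rewrite !in_itv /= ler_norml => /andP[? ?] /andP[? ?].
  by apply/andP; split; lra.
have [Pxc Px0 Pxd] := HP x xc.
have Pxx i t : t \in `[c, d] -> P x i t = x i t.
  move=> tcd; apply/eqP; rewrite -subr_eq0 -normr_le0.
  apply: (@le_geometric_le0 _ _ (4 * C * w t)) => k.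
  have h1 : `|P x i t - Y k.+1 i t| <= 2 * C / 2 ^+ k / 2 * w t.
    apply: (picard_contraction M0 _ t0cd AM Pxc (Yc k.+1) _ Pxd (YP k)) => //.
    - by rewrite divr_ge0 ?exprn_ge0// mulr_ge0// ltW.
    - by move=> j; rewrite Px0 Y0.
    - by move=> j s scd; exact: xY.
  have h2 := xY i t tcd k.+1; rewrite distrC in h2.
  rewrite -(subrKA (Y k.+1 i t)) (le_trans (ler_normD _ _))//.
  apply: le_trans (lerD h1 h2) _.
  have -> : 2 * C / 2 ^+ k / 2 * w t + 2 * C / 2 ^+ k.+1 * w t =
      2 * C * w t / 2 ^+ k by rewrite exprS; field; rewrite expf_neq0.
  rewrite ler_wpM2r ?invr_ge0 ?exprn_ge0// !ler_wpM2r ?(ltW C0)//.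
    by rewrite (le_trans _ (w1 t)).
  by lra.
exists (P x); last exact: Px0.
split=> // i t tcd; rewrite (_ : \sum_j _ = \sum_j A i j t * x j t); first exact: Pxd.
by apply: eq_bigr => j _; rewrite Pxx//; exact: subset_itv_oo_cc.
Qed.

Lemma cvg_complex (R : realType) (T : Type) (F : set_system T) (FF : Filter F)
    (z : T -> R[i]) (l : R[i]) :
  z @ F --> l <->
  (complex.Re (z t) @[t --> F] --> complex.Re l) /\
  (complex.Im (z t) @[t --> F] --> complex.Im l).
Proof.
have normi : `|'i%C : R[i]| = 1.
  by rewrite normc_def /= expr0n expr1n add0r sqrtr1.
have normR (x : R) : `|x%:C| = `|x|%:C.
  by rewrite normc_def /= expr0n addr0 sqrtr_sqr.
split.
  move=> /cvgrPdist_lt zl; split; apply/cvgrPdist_lt => e e0.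
    have eC : 0 < e%:C by rewrite ltcR.
    apply: filterS (zl _ eC) => t; rewrite -raddfB -ltcR; apply: le_lt_trans.
    exact: normc_ge_Re.
  have eC : 0 < e%:C by rewrite ltcR.
  apply: filterS (zl _ eC) => t; rewrite -raddfB -ltcR; apply: le_lt_trans.
  have := normc_ge_Re ((l - z t) * 'i%C); rewrite ReiNIm normrN.
  by rewrite normrM normi mulr1.
move=> [/cvgrPdist_lt zr /cvgrPdist_lt zi]; apply/cvgrPdist_lt => e e0.
have [e1 ee] : 0 < complex.Re e /\ e = (complex.Re e)%:C.
  by move: e0; case: (e) => a b; rewrite ltcE /= => /andP[/eqP-> ?]; split.
have e2 : 0 < complex.Re e / 2 by rewrite divr_gt0.
near=> t.
rewrite ee [l - z t]complexE (le_lt_trans (ler_normD _ _))//.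
rewrite normrM normi mul1r.
rewrite !normR.
rewrite -raddfD ltcR [ltRHS]splitr ltrD// !raddfB/=; near: t.
  exact: zr.
exact: zi.
Unshelve. all: by end_near. Qed.

Lemma cvg_mx_entry (K : numFieldType) (T : Type) (F : set_system T)
    (FF : Filter F) (m n : nat) (M : T -> 'M[K]_(m, n)) (L : 'M[K]_(m, n)) :
  M @ F --> L <-> forall i j, M t i j @[t --> F] --> L i j.
Proof.
split=> [ML i j|ML].
  exact: (cvg_comp _ _ ML (@coord_continuous K m n i j L)).
move=> V [B BL BV]; apply: (@filterS _ _ _ _ _ (fun t H => BV (M t) H)).
by apply: filter_forall => i; apply: filter_forall => j; exact: ML (BL i j).
Qed.

Definition part (R : realType) (b : bool) (z : R[i]) : R :=
  if b then complex.Im z else complex.Re z.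

Lemma cvg_cV_part (R : realType) (n : nat) (T : Type) (F : set_system T)
    (FF : Filter F) (v : T -> 'cV[R[i]]_n) (l : 'cV[R[i]]_n) :
  v @ F --> l <->
  forall p : 'I_n * bool, part p.2 (v t p.1 0) @[t --> F] --> part p.2 (l p.1 0).
Proof.
split=> [/cvg_mx_entry vl [i b]|vl].
  by have /cvg_complex[] := vl i 0; case: b.
apply/cvg_mx_entry => i j; rewrite ord1; apply/cvg_complex.
by split; [exact: (vl (i, false))|exact: (vl (i, true))].
Qed.

Definition clamp (R : realType) (a b t : R) : R := Num.max a (Num.min b t).

Lemma clamp_in (R : realType) (a b t : R) : a <= b -> clamp a b t \in `[a, b].
Proof. by move=> ab; rewrite in_itv /= le_max lexx ge_max ab ge_min lexx. Qed.

Lemma clamp_id (R : realType) (a b t : R) : t \in `[a, b] -> clamp a b t = t.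
Proof.
by rewrite in_itv /= => /andP[at_ tb]; rewrite /clamp (min_idPr tb) (max_idPr at_).
Qed.

Lemma continuous_clamp (R : realType) (a b : R) (f : R -> R) :
  a <= b -> {within `[a, b], continuous f} -> continuous (f \o clamp a b).
Proof.
move=> ab /subspace_continuousP fc t.
have cc : {for t, continuous (clamp a b)}.
  apply: (@continuous_max _ _ (cst a) (fun s => Num.min b s)).
    exact: cst_continuous.
  by apply: (@continuous_min _ _ (cst b) id); [exact: cst_continuous|exact: cvg_id].
move=> V fV; have := cc _ (fc _ (clamp_in t ab) V fV).
apply: (@filterS _ (nbhs t) _ _ _ _) => s /= H; exact: H (clamp_in s ab).
Qed.

Lemma cvg_diff_quotient (R : realType) (f : R -> R) (t df : R) :
  is_derive t 1 f df -> (s - t)^-1 * (f s - f t) @[s --> t^'] --> df.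
Proof.
move=> fd; have [dfx fdE] := fd.
have sub0 : (s - t) @[s --> t^'] --> (0 : R)^'.
  move=> V /=; rewrite /dnbhs /within /= => HV.
  have : (s - t) @[s --> t] --> (0 : R).
    rewrite -[X in _ --> X](subrr t); apply: cvgB; first exact: cvg_id.
    exact: cvg_cst.
  move=> /(_ _ HV); apply: (@filterS _ (nbhs t) _ _ _ _) => s /= Vs st; apply: Vs.
  by rewrite subr_eq0.
have := cvg_comp _ _ sub0 dfx; rewrite -/(derive f t 1) fdE.
apply: cvg_trans; apply: near_eq_cvg; apply: nearW => s /=.
by rewrite /GRing.scale /= mulr1 subrK.
Qed.

Lemma solvesW (R : realType) (T : finType) (c d p q : R)
    (A B : T -> T -> R -> R) (g h x : T -> R -> R) :
  c <= p -> q <= d ->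
  (forall i j t, t \in `]p, q[ -> A i j t = B i j t) ->
  (forall i t, t \in `]p, q[ -> g i t = h i t) ->
  solves c d A g x -> solves p q B h x.
Proof.
move=> cp qd AB gh [xc xd]; split=> [i|i t tpq].
  by apply: continuous_subspaceW (xc i); apply: subset_itv; rewrite bnd_simp.
have tcd : t \in `]c, d[.
  by move: tpq; rewrite !in_itv /= => /andP[pt tq]; rewrite (le_lt_trans cp pt) (lt_le_trans tq qd).
rewrite -(gh i t tpq) (eq_bigr (fun j => A i j t * x j t)); first exact: xd.
by move=> j _; rewrite AB.
Qed.

Lemma interval_upper_nbhs (R : realType) (I : set R) (t t0 : R) : I t -> I t0 ->
  exists b, [/\ I b, Num.max t t0 <= b & \forall s \near t, I s -> s <= b].
Proof.
move=> It It0.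
have Imax u : I u -> I (Num.max u t0) by rewrite /Num.max; case: ifP.
have [[s [Is ts]]|nos] := pselect (exists s, I s /\ t < s).
  exists (Num.max s t0); split; first exact: Imax.
    by rewrite ge_max !le_max lexx (ltW ts) orbT.
  near=> u => _; rewrite le_max; apply/orP; left; apply/ltW.
  by near: u; exact: lt_nbhsl.
exists (Num.max t t0); split=> //; first exact: Imax.
apply: (@nearW _ (nbhs t)) => s Is; rewrite le_max leNgt; apply/orP; left.
by apply/negP => ts; apply: nos; exists s.
Unshelve. all: by end_near. Qed.

Lemma interval_lower_nbhs (R : realType) (I : set R) (t t0 : R) : I t -> I t0 ->
  exists a, [/\ I a, a <= Num.min t t0 & \forall s \near t, I s -> a <= s].
Proof.
move=> It It0.
have Imin u : I u -> I (Num.min u t0) by rewrite /Num.min; case: ifP.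
have [[s [Is ts]]|nos] := pselect (exists s, I s /\ s < t).
  exists (Num.min s t0); split; first exact: Imin.
    by rewrite le_min !ge_min lexx (ltW ts) orbT.
  near=> u => _; rewrite ge_min; apply/orP; left; apply/ltW.
  by near: u; exact: lt_nbhsr.
exists (Num.min t t0); split=> //; first exact: Imin.
apply: (@nearW _ (nbhs t)) => s Is; rewrite ge_min leNgt; apply/orP; left.
by apply/negP => ts; apply: nos; exists s.
Unshelve. all: by end_near. Qed.

Lemma linear_system_on_interval (R : realType) (T : finType) (I : set R) (t0 : R)
    (A : T -> T -> R -> R) (g : T -> R -> R) :
  is_interval I -> I t0 ->
  (forall i j, {within I, continuous (A i j)}) ->
  (forall i, {within I, continuous (g i)}) ->
  exists x : T -> R -> R, forall i t, I t ->
    (s - t)^-1 * (x i s - x i t) @[s --> within I t^'] -->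
      \sum_j A i j t * x j t + g i t.
Proof.
move=> itvI It0 Ac gc.
have subI a b : I a -> I b -> `[a, b]%classic `<=` I.
  by move=> Ia Ib s /=; rewrite in_itv /= => abs; exact: itvI Ia Ib _ abs.
have /choice[S HS] : forall ab : R * R, exists x : T -> R -> R,
    I ab.1 -> I ab.2 -> ab.1 <= t0 <= ab.2 ->
    solves (ab.1 - 1) (ab.2 + 1) (fun i j => A i j \o clamp ab.1 ab.2)
      (fun i => g i \o clamp ab.1 ab.2) x /\ forall i, x i t0 = 0.
  move=> [a b] /=.
  have [[Ia Ib /andP[at0 t0b]]|no] := pselect [/\ I a, I b & a <= t0 <= b]; last first.
    by exists (fun _ _ => 0) => *; exfalso; exact: no.
  have ab := le_trans at0 t0b.
  have t0ab : t0 \in `[a - 1, b + 1] by rewrite in_itv /=; apply/andP; split; lra.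
  have Acl i j : {within `[a - 1, b + 1], continuous (A i j \o clamp a b)}.
    apply: continuous_subspaceT; apply: continuous_clamp => //.
    exact: continuous_subspaceW (subI _ _ Ia Ib) (Ac i j).
  have gcl i : {within `[a - 1, b + 1], continuous (g i \o clamp a b)}.
    apply: continuous_subspaceT; apply: continuous_clamp => //.
    exact: continuous_subspaceW (subI _ _ Ia Ib) (gc i).
  by have [x xs x0] := linear_ivp_solution t0ab Acl gcl; exists x.
(* [S] depends on the interval; at [t] the hull of [t] and [t0] is used, and by
   uniqueness any larger interval gives the same value. *)
pose x i t := S (Num.min t t0, Num.max t t0) i t.
have Imin t : I t -> I (Num.min t t0) by rewrite /Num.min; case: ifP.
have Imax t : I t -> I (Num.max t t0) by rewrite /Num.max; case: ifP.
have restrS a b p q : I a -> I b -> a <= t0 <= b -> a <= p -> q <= b ->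
    solves p q A g (S (a, b)).
  move=> Ia Ib abt ap qb; have [Sab _] := HS (a, b) Ia Ib abt.
  apply: solvesW Sab => /=; [lra|lra| |].
    move=> i j t; rewrite in_itv /= => /andP[pt tq].
    by rewrite clamp_id// in_itv /= (le_trans ap (ltW pt)) (le_trans (ltW tq) qb).
  move=> i t; rewrite in_itv /= => /andP[pt tq].
  by rewrite clamp_id// in_itv /= (le_trans ap (ltW pt)) (le_trans (ltW tq) qb).
have xE a b t i : I a -> I b -> a <= t0 <= b -> I t -> a <= t <= b ->
    x i t = S (a, b) i t.
  move=> Ia Ib abt0 It abt.
  have mM : Num.min t t0 <= t0 <= Num.max t t0 by rewrite ge_min le_max lexx !orbT.
  apply: (@solves_unique R T (Num.min t t0) (Num.max t t0) t0 A g
    (S (Num.min t t0, Num.max t t0)) (S (a, b))).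
  - by rewrite in_itv.
  - by move=> j k; exact: continuous_subspaceW (subI _ _ (Imin _ It) (Imax _ It)) (Ac j k).
  - by apply: restrS => //; [exact: Imin|exact: Imax].
  - apply: (restrS a b) => //; first by rewrite le_min; lra.
    by rewrite ge_max; lra.
  - move=> j; have [_ ->] := HS (_, _) (Imin _ It) (Imax _ It) mM.
    by have [_ ->] := HS (_, _) Ia Ib abt0.
  - by rewrite in_itv /= ge_min le_max lexx.
exists x => i t It.
have [b [Ib tb bnear]] := interval_upper_nbhs It It0.
have [a [Ia ta anear]] := interval_lower_nbhs It It0.
move: tb ta; rewrite ge_max le_min => /andP[tb t0b] /andP[at_ at0].
have abt0 : a <= t0 <= b by rewrite at0.
have abt : a <= t <= b by rewrite at_.
have [[_ Sd] _] := HS (a, b) Ia Ib abt0.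
have tin : t \in `]a - 1, b + 1[ by rewrite in_itv /=; apply/andP; split; lra.
have := cvg_diff_quotient (Sd i t tin); rewrite /= clamp_id ?in_itv//=.
rewrite (eq_bigr (fun j => A i j t * x j t)); last by move=> j _; rewrite (xE a b).
move=> /(@cvg_within_filter _ _ _ _ _ _ I); apply: cvg_trans; apply: near_eq_cvg.
have near_ab : \forall s \near t, I s -> a <= s <= b.
  near=> s => Is; apply/andP; split; move: Is; near: s; [exact: anear|exact: bnear].
have : \forall s \near within I t^', a <= s <= b /\ I s.
  rewrite /within /dnbhs /within /=; apply: filterS near_ab => s H _ Is.
  by split; [exact: H|].
by apply: filterS => s [abs Is]; rewrite /= !(xE a b).
Unshelve. all: by end_near. Qed.

Lemma partD (R : realType) b : {morph @part R b : z w / z + w}.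
Proof. by move=> [a1 a2] [b1 b2]; case: b. Qed.

Lemma part0 (R : realType) b : @part R b 0 = 0.
Proof. by case: b. Qed.

Lemma part_sum (R : realType) b (J : finType) (F : J -> R[i]) :
  part b (\sum_j F j) = \sum_j part b (F j).
Proof. exact: (big_morph _ (@partD R b) (part0 R b)). Qed.

Lemma partZ (R : realType) b (r : R) (z : R[i]) : part b (r%:C * z) = r * part b z.
Proof.
by case: z b => z1 z2 [] /=; rewrite /part /= mul0r ?subr0 ?addr0.
Qed.

Lemma partM (R : realType) b (z w : R[i]) : part b (z * w) =
  \sum_(c : bool) (if b == c then complex.Re z else if b then complex.Im z else - complex.Im z)
    * part c w.
Proof.
case: z w => [z1 z2] [w1 w2]; rewrite big_bool /part.
by case: b => //=; rewrite mulNr addrC.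
Qed.

Lemma linear_ode_solution (R : realType) (n : nat) (I : set R)
    (A : R -> 'M[R[i]]_n) (h : R -> 'cV[R[i]]_n) :
  is_interval I -> {within I, continuous A} -> {within I, continuous h} ->
  exists x, is_solution I A h x.
Proof.
move=> itvI /subspace_continuousP Ac /subspace_continuousP hc.
have [[t0 It0]|noI] := pselect (exists t0, I t0); last first.
  by exists (fun=> 0) => t It; exfalso; apply: noI; exists t.
pose C (p q : 'I_n * bool) t := if p.2 == q.2 then complex.Re (A t p.1 q.1)
  else if p.2 then complex.Im (A t p.1 q.1) else - complex.Im (A t p.1 q.1).
pose g (p : 'I_n * bool) t := part p.2 (h t p.1 0).
have Cc p q : {within I, continuous (C p q)}.
  apply/subspace_continuousP => t It.
  have [rc ic] := (cvg_complex _ _ _).1 ((cvg_mx_entry _ _ _).1 (Ac t It) p.1 q.1).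
  by rewrite /C; case: (p.2 == q.2) => //; case: p.2 => //; exact: cvgN.
have gc p : {within I, continuous (g p)}.
  by apply/subspace_continuousP => t It; exact: ((cvg_cV_part _ _ _).1 (hc t It) p).
have [x Hx] := linear_system_on_interval itvI It0 Cc gc.
pose X t : 'cV[R[i]]_n := \col_i (x (i, false) t +i* x (i, true) t).
have partX p t : part p.2 (X t p.1 0) = x p t.
  by case: p => i b; rewrite /X mxE /part; case: b.
exists X => t It; apply/cvg_cV_part => p.
have -> : part p.2 ((A t *m X t + h t) p.1 0) = \sum_q C p q t * x q t + g p t.
  rewrite mxE partD mxE part_sum; congr (_ + _).
  transitivity (\sum_i \sum_b C p (i, b) t * x (i, b) t); last first.
    by rewrite pair_bigA; apply: eq_bigr => -[].
  apply: eq_bigr => j _; rewrite partM; apply: eq_bigr => b _.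
  by rewrite -(partX (j, b)).
move: (Hx p t It); apply: cvg_trans; apply: near_eq_cvg; apply: nearW => s /=.
rewrite !mxE -fmorphV partZ; congr (_ * _).
by case: p => i [].
Qed.

Lemma has_derivative_on_continuous (R : realType) (n : nat) (I : set R)
    (x dx : R -> 'cV[R[i]]_n) :
  has_derivative_on I x dx -> {within I, continuous x}.
Proof.
move=> xd; apply/subspace_continuousP => t It.
have tC : (s - t)%:C @[s --> within I t^'] --> (0 : R[i]).
  apply/cvg_complex; split=> /=; last exact: cvg_cst.
  rewrite -[X in _ --> X](subrr t); apply: cvgB; last exact: cvg_cst.
  apply: cvg_trans (cvg_within _) _.
  exact: cvg_trans (cvg_within _) _.
have := cvgD (cvgZ tC (xd t It)) (cvg_cst (x t)).
rewrite scale0r add0r => xc V /[dup] Vt /xc /=.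
rewrite /within /dnbhs /within /=; apply: (@filterS _ (nbhs t) _ _ _ _) => s /= H Is.
have [->|st] := eqVneq s t; first exact: nbhs_singleton.
have := H st Is; rewrite !fctE scalerA mulfV ?scale1r ?subrK//.
by rewrite fmorph_eq0 subr_eq0.
Qed.

Lemma has_derivative_onB (R : realType) (n : nat) (I : set R)
    (x dx y dy : R -> 'cV[R[i]]_n) :
  has_derivative_on I x dx -> has_derivative_on I y dy ->
  has_derivative_on I (fun t => x t - y t) (fun t => dx t - dy t).
Proof.
move=> xd yd t It; apply: (cvg_trans _ (cvgB (xd t It) (yd t It))).
apply: near_eq_cvg; apply: nearW => s /=.
by rewrite !fctE -scalerBr !opprD !opprK addrACA.
Qed.

Lemma has_derivative_onD (R : realType) (n : nat) (I : set R)
    (x dx y dy : R -> 'cV[R[i]]_n) :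
  has_derivative_on I x dx -> has_derivative_on I y dy ->
  has_derivative_on I (fun t => x t + y t) (fun t => dx t + dy t).
Proof.
move=> xd yd t It; apply: (cvg_trans _ (cvgD (xd t It) (yd t It))).
apply: near_eq_cvg; apply: nearW => s /=.
by rewrite !fctE -scalerDr opprD addrACA.
Qed.

Lemma cvg_mulmx (K : numFieldType) (T : Type) (F : set_system T)
    (FF : Filter F) (m n p : nat) (M : T -> 'M[K]_(m, n)) (N : T -> 'M[K]_(n, p))
    (L : 'M[K]_(m, n)) (P : 'M[K]_(n, p)) :
  M @ F --> L -> N @ F --> P -> M t *m N t @[t --> F] --> L *m P.
Proof.
move=> /cvg_mx_entry ML /cvg_mx_entry NP; apply/cvg_mx_entry => i j.
rewrite mxE (_ : (fun t => _) = (fun t => \sum_k M t i k * N t k j)); last first.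
  by apply/funext => t; rewrite mxE.
by apply: cvg_big => [|k _]; [exact: add_continuous|exact: cvgM].
Qed.

Lemma ulam_stable_with_shift (R : realType) (n : nat) (N : 'cV[R[i]]_n -> R)
    (I : set R) (A : R -> 'M[R[i]]_n) (f g x0 : R -> 'cV[R[i]]_n) (K : R) :
  {within I, continuous A} -> {within I, continuous (fun t => g t - f t)} ->
  is_solution I A (fun t => g t - f t) x0 ->
  ulam_stable_with N I A f K -> ulam_stable_with N I A g K.
Proof.
move=> Ac hc x0d [K0 Hf]; split=> // eps phi dphi e0 [phid dphic] defect.
pose dx0 t := A t *m x0 t + (g t - f t).
have dx0c : {within I, continuous dx0}.
  apply/subspace_continuousP => t It; apply: cvgD.
    apply: cvg_mulmx; first by move/subspace_continuousP: Ac; exact.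
    by have /subspace_continuousP := has_derivative_on_continuous x0d; exact.
  by move/subspace_continuousP: hc; exact.
have C1 : C1_on I (fun t => phi t - x0 t) (fun t => dphi t - dx0 t).
  split; first exact: (has_derivative_onB phid x0d).
  by move=> t; exact: (continuousB (dphic t) (dx0c t)).
have [|x [xd xphi]] := Hf eps _ _ e0 C1.
  rewrite (_ : (fun t => _) = (fun t => dphi t - A t *m phi t - g t))//.
  apply/funext => t; rewrite /dx0 mulmxBr.
  set a := A t *m phi t; set b := A t *m x0 t.
  by apply/matrixP => i j; rewrite !mxE; ring.
exists (fun t => x t + x0 t); split.
  have := has_derivative_onD xd x0d; congr has_derivative_on; apply/funext => t.
  by rewrite mulmxDr addrACA [f t + _]addrC subrK.
rewrite (_ : (fun t => _) = (fun t => phi t - x0 t - x t))//.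
by apply/funext => t; rewrite opprD addrA addrAC.
Qed.

Theorem theorem2p1 (R : realType) (n : nat) (N : 'cV[R[i]]_n -> R)
    (hN : is_norm N) (I : set R) (hI : is_interval I)
    (A : R -> 'M[R[i]]_n) (hA : {within I, continuous A})
    (f : R -> 'cV[R[i]]_n) (hf : {within I, continuous f})
    (K : R) (hK : 0 < K) :
  ulam_stable_with N I A f K <-> ulam_stable_with N I A (fun=> 0) K.
Proof.
split.
  have hNf : {within I, continuous (fun t => 0 - f t)}.
    by move=> t; exact: (continuousB (cvg_cst (0 : 'cV[R[i]]_n)) (hf t)).
  have [x0 x0d] := linear_ode_solution hI hA hNf.
  exact: ulam_stable_with_shift hA hNf x0d.
have hf0 : {within I, continuous (fun t => f t - 0)}.
  by move=> t; exact: (continuousB (hf t) (cvg_cst (0 : 'cV[R[i]]_n))).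
have [x0 x0d] := linear_ode_solution hI hA hf0.
exact: ulam_stable_with_shift hA hf0 x0d.
Qed.
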